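(* Consider a forward complete system $\frac{d}{dt}x(t)=f(x(t),w(t))$, $x(0)\in\mathbb{R}^n$, $w\in\mathcal{W}^m$, where $f:\mathbb{R}^n\times\mathbb{R}^m\to\mathbb{R}^n$ is locally Lipschitz in its first argument, locally uniformly in its second argument. (i) If the system has linear $\mathcal{L}_2$-gain, then it is input-to-state stable (ISS). (ii) Conversely, let $\bar\gamma>0$ be arbitrary. If the system is ISS, then there exist changes of coordinates $S:\mathbb{R}^m\to\mathbb{R}^m$ for the input and $T:\mathbb{R}^n\to\mathbb{R}^n$ for the state such that the system in the new coordinates has linear $\mathcal{L}_2$-gain with gain $\bar\gamma^2$; that is, there exists $\tilde\beta\in\mathcal{K}_\infty$ such that $$\|T(x)\|_{\mathcal{L}_2[0,t]}^2\le\max\left\{\tilde\beta(|T(x(0))|),\ \bar\gamma^2\|S(w)\|_{\mathcal{L}_2[0,t]}^2\right\}$$ for all $x(0)\in\mathbb{R}^n$, $w\in\mathcal{W}^m$, $t\in\mathbb{R}_{\ge0}$, where $T(x)$ and $S(w)$ denote the functions $\tau\mapsto T(x(\tau))$ and $\tau\mapsto S(w(\tau))$.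
   Context: $\mathcal{W}^m$ is the set of measurable, locally essentially bounded functions $w:\mathbb{R}_{\ge0}\to\mathbb{R}^m$. Forward complete means that for every initial condition and every input $w\in\mathcal{W}^m$ the solution exists for all $t\ge 0$. $\mathcal{K}_\infty$ is the class of continuous, strictly increasing, unbounded functions $\alpha:\mathbb{R}_{\ge0}\to\mathbb{R}_{\ge0}$ with $\alpha(0)=0$. $|\cdot|$ is the Euclidean norm, and $\|y\|_{\mathcal{L}_2[0,t]}^2:=\int_0^t|y(\tau)|^2d\tau$. The system is ISS if there exist $\alpha,\beta,\sigma\in\mathcal{K}_\infty$ such that $\int_0^t\alpha(|x(\tau)|)d\tau\le\max\{\beta(|x(0)|),\int_0^t\sigma(|w(\tau)|)d\tau\}$ for all $x(0)\in\mathbb{R}^n$, $w\in\mathcal{W}^m$, $t\ge0$. The system has linear $\mathcal{L}_2$-gain if there exist $\beta\in\mathcal{K}_\infty$ and $\bar\gamma\in\mathbb{R}_{\ge0}$ such that $\|x\|_{\mathcal{L}_2[0,t]}^2\le\max\{\beta(|x(0)|),\bar\gamma^2\|w\|_{\mathcal{L}_2[0,t]}^2\}$ for all $x(0)\in\mathbb{R}^n$, $w\in\mathcal{W}^m$, $t\ge0$. A change of coordinates is a homeomorphism $T:\mathbb{R}^p\to\mathbb{R}^p$ with $T(0)=0$ (differentiability is not required). *)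

(* Defs.v *)
From HB Require Import structures.
From mathcomp Require Import all_boot all_order all_algebra.
From mathcomp Require Import all_classical all_reals all_analysis.

Set Implicit Arguments.
Unset Strict Implicit.
Unset Printing Implicit Defensive.

Import Order.TTheory GRing.Theory Num.Theory.
Import numFieldNormedType.Exports.

Local Open Scope classical_set_scope.
Local Open Scope ring_scope.

(* The norm the library puts on ['rV[R]_n] is the maximum norm; it is only used
   here through the topology it induces. *)
Definition enorm (R : realType) (n : nat) (v : 'rV[R]_n) : R :=
  Num.sqrt (\sum_(i < n) v ord0 i ^+ 2).

(* [R] with the sigma-algebra of Lebesgue-measurable (not just Borel) sets, on
   which [completed_lebesgue_measure] is a measure. *)
Notation lebesgueTypeR R := (caratheodory_type (mu_ext (@wlength R idfun))).

(* Time is represented by the whole line: functions of time are total on [R]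
   and every condition below only involves their values on [0, +oo[. *)

Definition is_input (R : realType) (m : nat) (w : R -> 'rV[R]_m) : Prop :=
  (forall i : 'I_m,
     measurable_fun (`[0, +oo[%classic : set (lebesgueTypeR R))
       (fun s : lebesgueTypeR R => w s ord0 i)) /\
  (forall t : R, exists M : R,
     {ae @completed_lebesgue_measure R,
       forall s, `[0, t]%classic s -> enorm (w s) <= M}).

Definition locally_lipschitz_fst (R : realType) (n m : nat)
    (f : 'rV[R]_n -> 'rV[R]_m -> 'rV[R]_n) : Prop :=
  forall (x0 : 'rV[R]_n) (w0 : 'rV[R]_m),
    exists (L : R) (U : set 'rV[R]_n) (V : set 'rV[R]_m),
      [/\ nbhs x0 U, nbhs w0 V &
        forall x y w, U x -> U y -> V w ->
          enorm (f x w - f y w) <= L * enorm (x - y)].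

Definition abs_continuous (R : realType) (n : nat) (a b : R)
    (x : R -> 'rV[R]_n) : Prop :=
  forall e : R, 0 < e -> exists2 d : R, 0 < d &
    forall (k : nat) (l r : 'I_k -> R),
      (forall i, a <= l i /\ l i <= r i /\ r i <= b) ->
      trivIset setT (fun i => `]l i, r i[%classic) ->
      \sum_(i < k) (r i - l i) < d ->
      \sum_(i < k) enorm (x (r i) - x (l i)) < e.

(* Solutions on [0, +oo[ in the sense of Caratheodory, the usual sense of the
   differential equation when the input is only measurable. *)
Definition solution (R : realType) (n m : nat)
    (f : 'rV[R]_n -> 'rV[R]_m -> 'rV[R]_n)
    (w : R -> 'rV[R]_m) (x : R -> 'rV[R]_n) : Prop :=
  (forall t : R, 0 <= t -> abs_continuous 0 t x) /\
  {ae @completed_lebesgue_measure R,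
    forall t : R, 0 < t -> is_derive t 1 x (f (x t) (w t))}.

Definition forward_complete (R : realType) (n m : nat)
    (f : 'rV[R]_n -> 'rV[R]_m -> 'rV[R]_n) : Prop :=
  forall (x0 : 'rV[R]_n) (w : R -> 'rV[R]_m), is_input w ->
    exists2 x : R -> 'rV[R]_n, x 0 = x0 & solution f w x.

Definition class_Kinfty (R : realType) (a : R -> R) : Prop :=
  [/\ a 0 = 0,
      {within `[0, +oo[%classic, continuous a},
      {in `[0, +oo[ &, {homo a : r s / r < s}} &
      forall M : R, exists2 s : R, 0 <= s & M < a s].

Definition change_of_coordinates (R : realType) (p : nat)
    (T : 'rV[R]_p -> 'rV[R]_p) : Prop :=
  T 0 = 0 /\
  exists T' : 'rV[R]_p -> 'rV[R]_p,
    [/\ cancel T T', cancel T' T, continuous T & continuous T'].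

(* The integral is extended-real valued, so that no integrability side condition
   is needed. *)
Definition cost (R : realType) (n : nat) (a : R -> R) (y : R -> 'rV[R]_n)
    (t : R) : \bar R :=
  (\int[@completed_lebesgue_measure R]_(s in `[0%R, t]%classic)
     (a (enorm (y s)))%:E)%E.

Definition L2normsq (R : realType) (n : nat) (y : R -> 'rV[R]_n)
    (t : R) : \bar R :=
  cost (fun r => r ^+ 2) y t.

Definition ISS (R : realType) (n m : nat)
    (f : 'rV[R]_n -> 'rV[R]_m -> 'rV[R]_n) : Prop :=
  exists alpha beta sigma : R -> R,
    [/\ class_Kinfty alpha, class_Kinfty beta, class_Kinfty sigma &
      forall (w : R -> 'rV[R]_m) (x : R -> 'rV[R]_n) (t : R),
        is_input w -> solution f w x -> 0 <= t ->
        (cost alpha x t <=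
           maxe (beta (enorm (x 0)))%:E (cost sigma w t))%E].

Definition linear_L2_gain (R : realType) (n m : nat)
    (f : 'rV[R]_n -> 'rV[R]_m -> 'rV[R]_n) : Prop :=
  exists (beta : R -> R) (gamma : R),
    [/\ class_Kinfty beta, 0 <= gamma &
      forall (w : R -> 'rV[R]_m) (x : R -> 'rV[R]_n) (t : R),
        is_input w -> solution f w x -> 0 <= t ->
        (L2normsq x t <=
           maxe (beta (enorm (x 0)))%:E ((gamma ^+ 2)%:E * L2normsq w t))%E].

(* Main.v *)
(** A class K_infinity function [a] defines a radial homeomorphism
    v |-> a(|v|) v / |v|, which turns the norm |v| into a(|v|); its inverse is
    the radial map of the inverse of [a].  Given the ISS estimate with [alpha],
    [beta], [sigma], let T and S be the radial maps of sqrt(alpha) and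
    sqrt(sigma / gamma^2): then |T(x)|^2 = alpha(|x|) and
    gamma^2 |S(w)|^2 = sigma(|w|), so that the ISS estimate is literally the
    L2-gain estimate in the new coordinates, with [beta] composed with the
    inverse of sqrt(alpha). *)

Require Import Defs.
From mathcomp Require Import all_boot all_order all_algebra.
From mathcomp Require Import all_classical all_reals all_analysis.
From mathcomp Require Import measurable_realfun lra.

Import Order.TTheory GRing.Theory Num.Theory.
Import numFieldNormedType.Exports.

Local Open Scope classical_set_scope.
Local Open Scope ring_scope.

(** * Comparison functions: surjectivity, continuity, closure properties and inverses *)

Section Kinfty.
Local Set Implicit Arguments.
Local Unset Strict Implicit.
Context {R : realType}.
Implicit Types a b : R -> R.

Lemma Kinfty_lt a r s : class_Kinfty a -> 0 <= r -> r < s -> a r < a s.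
Proof.
case=> _ _ ainc _ r0 rs; apply: ainc => //; rewrite in_itv/= andbT//.
exact: le_trans r0 (ltW rs).
Qed.

Lemma Kinfty_le a r s : class_Kinfty a -> 0 <= r -> r <= s -> a r <= a s.
Proof.
move=> Ka r0; rewrite le_eqVlt => /predU1P[->//|rs].
exact/ltW/Kinfty_lt.
Qed.

Lemma Kinfty_ge0 a r : class_Kinfty a -> 0 <= r -> 0 <= a r.
Proof. by move=> Ka r0; case: (Ka) => <- _ _ _; exact: Kinfty_le. Qed.

Lemma Kinfty_surj a y : class_Kinfty a -> 0 <= y -> exists2 s, 0 <= s & a s = y.
Proof.
move=> Ka y0; case: (Ka) => a0 acont _ aunb.
have [s s0 ys] := aunb y.
have acont' : {within `[0, s], continuous a}.
  by apply: continuous_subspaceW acont => x /=; rewrite !in_itv/= => /andP[->].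
have [|c] := @IVT R a 0 s y s0 acont'.
  by rewrite a0 ge_min y0/= le_max (ltW ys) orbT.
by rewrite in_itv/= => /andP[c0 _] <-; exists c.
Qed.

(** A discontinuity of an increasing function is a jump, which would leave a gap in its range. The
    argument is carried out on a segment around each point. *)
Lemma continuous_inc_surj a : {homo a : r s / r < s} ->
  (forall y, exists s, a s = y) -> continuous a.
Proof.
move=> ainc asurj x.
have amono : {mono a : r s / r <= s} := le_mono ainc.
have cont : {within `[x - 1, x + 1], continuous a}.
  apply: segment_inc_surj_continuous.
    by move=> r s _ _; exact: amono.
  move=> y /=; have [s <-] := asurj y.
  by rewrite in_itv/= !amono => xs; exists s => //=; rewrite in_itv.
have [|+ _ _] := (continuous_within_itvP a _).1 cont; first by lra.
by apply; rewrite in_itv/=; lra.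
Qed.

(* Extended by the identity on ]-oo, 0[, [a] becomes an increasing bijection of
   the line, and these are continuous. *)
Lemma Kinfty_of_surj a : a 0 = 0 ->
  {in `[0, +oo[ &, {homo a : r s / r < s}} ->
  (forall y, 0 <= y -> exists2 s, 0 <= s & a s = y) ->
  class_Kinfty a.
Proof.
move=> a0 ainc asurj.
have a_ge0 r : 0 <= r -> 0 <= a r.
  rewrite le_eqVlt => /predU1P[<-|r0]; first by rewrite a0.
  by rewrite -a0 ltW// ainc// in_itv/= andbT// ltW.
split=> //; last first.
  move=> M; have [|s s0 as_] := asurj (`|M| + 1); first by rewrite addr_ge0.
  by exists s => //; rewrite as_ (le_lt_trans (ler_norm M))// ltrDl.
pose a' (r : R) : R := if r < 0 then r else a r.
have a'cont : continuous a'.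
  apply: continuous_inc_surj => [r s rs|y]; rewrite /a'.
  - case: (ltP r 0) => r0; case: (ltP s 0) => s0 //.
    + exact: lt_le_trans r0 (a_ge0 s s0).
    + by have := le_lt_trans r0 rs; rewrite ltNge (ltW s0).
    + by apply: ainc; rewrite // in_itv/= andbT.
  - case: (ltP y 0) => y0; first by exists y; rewrite y0.
    by have [s s0 <-] := asurj y y0; exists s; rewrite ltNge s0.
have := @continuous_subspaceT _ _ (`[0, +oo[ : set R) _ a'cont.
apply: subspace_eq_continuous => x.
rewrite inE/= in_itv/= andbT => x0.
by rewrite /from_subspace /a' ltNge x0.
Qed.

Lemma Kinfty_comp a b :
  class_Kinfty a -> class_Kinfty b -> class_Kinfty (a \o b).
Proof.
move=> Ka Kb; apply: Kinfty_of_surj => /=.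
- by case: Ka Kb => a0 _ _ _ [-> _ _ _].
- move=> r s; rewrite !in_itv/= !andbT => r0 s0 rs.
  by apply: Kinfty_lt => //; [exact: Kinfty_ge0|exact: Kinfty_lt].
- move=> y /(Kinfty_surj Ka)[z /(Kinfty_surj Kb)[s s0 <-] <-].
  by exists s.
Qed.

Lemma Kinfty_scale (c : R) : 0 < c -> class_Kinfty ( *%R c).
Proof.
move=> c0; apply: Kinfty_of_surj => [|r s _ _ rs|y y0]; first by rewrite mulr0.
  by rewrite ltr_pM2l.
exists (c^-1 * y); first by rewrite mulr_ge0// invr_ge0 ltW.
by rewrite mulrA divff ?mul1r// gt_eqF.
Qed.

Lemma Kinfty_sqr : class_Kinfty (fun r : R => r ^+ 2).
Proof.
apply: Kinfty_of_surj => [|r s|y y0]; first by rewrite expr0n.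
  rewrite !in_itv/= !andbT => r0 s0 rs.
  by rewrite ltr_pXn2r.
by exists (Num.sqrt y); [exact: sqrtr_ge0|rewrite sqr_sqrtr].
Qed.

Lemma Kinfty_sqrt : class_Kinfty (Num.sqrt : R -> R).
Proof.
apply: Kinfty_of_surj => [|r s|y y0]; first by rewrite sqrtr0.
  rewrite !in_itv/= !andbT => r0 s0 rs.
  by rewrite ltr_sqrt// (le_lt_trans r0).
by exists (y ^+ 2); [exact: sqr_ge0|rewrite sqrtr_sqr ger0_norm].
Qed.

(** Continuity of the inverse costs nothing extra: it is increasing and onto the half-line, so
    [Kinfty_of_surj] applies. *)
Lemma Kinfty_inv a : class_Kinfty a ->
  exists2 b, class_Kinfty b &
    (forall r, 0 <= r -> b (a r) = r) /\ (forall r, 0 <= r -> a (b r) = r).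
Proof.
move=> Ka.
have [b bP] : exists b : R -> R, forall y, 0 <= y -> 0 <= b y /\ a (b y) = y.
  (* The sign condition sits under the existential so that choice ranges over the whole line; on
     negative arguments [b] is unconstrained. *)
  suff /choice[b bP] y : exists s, 0 <= y -> 0 <= s /\ a s = y by exists b.
  have [y0|y0] := leP 0 y; last by exists 0.
  by have [s s0 as_] := Kinfty_surj Ka y0; exists s.
have b_ge0 y : 0 <= y -> 0 <= b y by move=> /bP[].
have bK y : 0 <= y -> a (b y) = y by move=> /bP[].
have aK r : 0 <= r -> b (a r) = r.
  move=> r0; have ar0 := Kinfty_ge0 Ka r0.
  have [h|h|//] := ltgtP (b (a r)) r.
    by have := Kinfty_lt Ka (b_ge0 _ ar0) h; rewrite bK// ltxx.
  by have := Kinfty_lt Ka r0 h; rewrite bK// ltxx.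
exists b => //; apply: Kinfty_of_surj.
- by case: (Ka) => a0 _ _ _; rewrite -{1}a0 aK.
(* By contraposition: applying [a] to [b s <= b r] gives [s <= r]. *)
- move=> r s; rewrite !in_itv/= !andbT => r0 s0; rewrite !ltNge.
  apply: contra => h; rewrite -(bK r)// -(bK s)//.
  by apply: Kinfty_le => //; exact: b_ge0.
- by move=> y y0; exists (a y); [exact: Kinfty_ge0|exact: aK].
Qed.

(** Two-sided continuity is available at interior points only: the values of [a] on negative numbers
    are arbitrary, so it may fail at 0. *)
Lemma Kinfty_continuous_gt0 a r :
  class_Kinfty a -> 0 < r -> {for r, continuous a}.
Proof.
move=> [_ /continuous_within_itvcyP[acont _] _ _] r0.
by apply: acont; rewrite in_itv/= andbT.
Qed.

End Kinfty.

(** * The Euclidean norm and radial homeomorphisms *)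

Section enorm.
Local Set Implicit Arguments.
Local Unset Strict Implicit.
Context {R : realType} {n : nat}.
Implicit Types (v : 'rV[R]_n) (a b : R -> R).

Lemma enorm_ge0 v : 0 <= enorm v.
Proof. exact: sqrtr_ge0. Qed.

Lemma enorm0 : enorm (0 : 'rV[R]_n) = 0.
Proof.
rewrite /enorm big1 ?sqrtr0// => i _.
by rewrite mxE expr0n.
Qed.

Lemma enormZ (k : R) v : enorm (k *: v) = `|k| * enorm v.
Proof.
rewrite /enorm -sqrtr_sqr -sqrtrM ?sqr_ge0// mulr_sumr.
by congr Num.sqrt; apply: eq_bigr => i _; rewrite mxE exprMn.
Qed.

(** Links the Euclidean norm to the norm that induces the topology; it gives positivity off the
    origin and convergence at the origin. *)
Lemma mx_norm_le_enorm v : `|v| <= enorm v.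
Proof.
rewrite [`|v|]mx_normrE; apply: bigmax_le => [|[i j] _]; first exact: enorm_ge0.
rewrite /= ord1 -sqrtr_sqr ler_wsqrtr// (bigD1 j)//= lerDl.
by apply: sumr_ge0 => k _; exact: sqr_ge0.
Qed.

Lemma enorm_gt0 v : v != 0 -> 0 < enorm v.
Proof. by rewrite -normr_gt0 => /lt_le_trans; apply; exact: mx_norm_le_enorm. Qed.

Lemma enorm_continuous : continuous (@enorm R n).
Proof.
move=> v; apply: (@continuous_comp _ _ _ _ Num.sqrt); last exact: sqrt_continuous.
move: v; apply: continuous_big => [|i _ v]; first exact: add_continuous.
apply: (@continuous_comp _ _ _ (fun v : 'rV[R]_n => v ord0 i)
  (fun r : R => r ^+ 2)).
  exact: coord_continuous.
exact: exprn_continuous.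
Qed.

(** The origin needs no case distinction: whatever the quotient is there, it multiplies the zero
    vector. *)
Definition radial a v : 'rV[R]_n := (a (enorm v) / enorm v) *: v.

Lemma radial0 a : radial a 0 = 0.
Proof. by rewrite /radial scaler0. Qed.

Lemma enorm_radial a v : class_Kinfty a -> enorm (radial a v) = a (enorm v).
Proof.
move=> Ka; have [->|v0] := eqVneq v 0.
  by rewrite radial0 enorm0; case: Ka => ->.
have v_gt0 := enorm_gt0 v0.
rewrite enormZ ger0_norm ?mulr_ge0 ?invr_ge0 ?(Kinfty_ge0 Ka) ?enorm_ge0//.
by rewrite divfK// gt_eqF.
Qed.

(** Off the origin the two scaling factors are [a r / r] and [r / a r] with [r = enorm v], and their
    product is 1. *)
Lemma radialK a b : class_Kinfty a ->
  (forall r, 0 <= r -> b (a r) = r) -> cancel (radial a) (radial b).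
Proof.
move=> Ka aK v; rewrite {1}/radial enorm_radial// aK ?enorm_ge0//.
have [->|v0] := eqVneq v 0; first by rewrite radial0 scaler0.
have v_gt0 := enorm_gt0 v0.
have av_gt0 : 0 < a (enorm v).
  by case: (Ka) => <- _ _ _; exact: Kinfty_lt.
rewrite /radial scalerA mulrA divfK ?divff ?scale1r ?gt_eqF//.
Qed.

(** Off the origin the scaling factor is itself continuous. At the origin it may blow up, as for a
    square root, but the norm of the image is [a (enorm v)], which tends to 0. *)
Lemma radial_continuous a : class_Kinfty a -> continuous (radial a).
Proof.
move=> Ka v; have [->|v0] := eqVneq v 0; last first.
  have v_gt0 := enorm_gt0 v0.
  have cont_ratio :
      {for v, continuous (fun u : 'rV[R]_n => a (enorm u) / enorm u)}.
    apply: continuousM; last first.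
      by apply: continuousV; [rewrite gt_eqF|exact: enorm_continuous].
    apply: continuous_comp; first exact: enorm_continuous.
    exact: Kinfty_continuous_gt0.
  exact: (@cvgZ R 'rV[R]_n _ (nbhs v) _ _ id _ _ cont_ratio cvg_id).
rewrite /continuous_at radial0.
apply/(@cvgr0Pnorm_lt R 'rV[R]_n _ (nbhs (0 : 'rV[R]_n)) _ (radial a)) => e e0.
(* The preimage [s] of [e] under [a] serves as the radius of the neighbourhood. *)
have [s s0 as_] := Kinfty_surj Ka (ltW e0).
have s_gt0 : 0 < s.
  rewrite lt_neqAle s0 andbT; apply: contraTneq e0 => s_eq0.
  by case: Ka => a0 _ _ _; rewrite -as_ -s_eq0 a0 ltxx.
have : \forall u \near (0 : 'rV[R]_n), enorm u < s.
  apply: (@cvgr_lt R _ (nbhs (0 : 'rV[R]_n)) _ (@enorm R n)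
    (enorm (0 : 'rV[R]_n))).
    exact: enorm_continuous.
  by rewrite enorm0.
apply: filterS => u us.
rewrite (le_lt_trans (mx_norm_le_enorm _))// enorm_radial// -as_.
by apply: Kinfty_lt => //; exact: enorm_ge0.
Qed.

Lemma change_of_coordinates_radial a :
  class_Kinfty a -> change_of_coordinates (radial a).
Proof.
move=> Ka; split; first exact: radial0.
have [b Kb [aK bK]] := Kinfty_inv Ka.
by exists (radial b); split;
  [exact: radialK|exact: radialK|exact: radial_continuous|exact: radial_continuous].
Qed.

End enorm.

(** * Integral costs: measurability, radial substitution and scaling *)

Section cost.
Local Set Implicit Arguments.
Local Unset Strict Implicit.
Context {R : realType}.
Implicit Types (a : R -> R) (t : R).
Local Notation mu := (@completed_lebesgue_measure R).

Lemma measurable_itv_completed (i : interval R) :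
  measurable ([set` i] : set (lebesgueTypeR R)).
Proof. by apply: sub_caratheodory; exact: measurable_itv. Qed.

(** Serves to move constants through the integral in [costZ]. *)
Lemma measurable_Kinfty_enorm n a (w : R -> 'rV[R]_n) t :
  class_Kinfty a -> is_input w ->
  measurable_fun (`[0, t]%classic : set (lebesgueTypeR R))
    (fun s : lebesgueTypeR R => a (enorm (w s))).
Proof.
move=> Ka [mw _].
have mnorm : measurable_fun (`[0, t]%classic : set (lebesgueTypeR R))
    (fun s : lebesgueTypeR R => enorm (w s)).
  apply: (@measurableT_comp _ _ _ _ _ _ (Num.sqrt : R -> R)).
    by apply: continuous_measurable_fun; exact: sqrt_continuous.
  apply: measurable_sum => i; apply: measurable_funX.
  apply: measurable_funS (mw i); first exact: measurable_itv_completed.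
  by move=> s /=; rewrite !in_itv/= => /andP[->].
(* [a] is monotone on [0, +oo[ only, so it is first made constant below 0. *)
rewrite (_ : (fun s => _) = (a \o Num.max 0) \o (fun s => enorm (w s))); last first.
  by apply/funext => s /=; rewrite max_r// enorm_ge0.
apply: measurableT_comp mnorm.
apply: nondecreasing_measurable => // r s rs /=.
apply: Kinfty_le => //; first by rewrite le_max lexx.
by rewrite ge_max !le_max lexx rs orbT.
Qed.

Lemma cost_radial n a b (y : R -> 'rV[R]_n) t : class_Kinfty b ->
  cost a (radial b \o y) t = cost (a \o b) y t.
Proof.
move=> Kb; apply: eq_integral => s _ /=.
by rewrite enorm_radial.
Qed.

Lemma eq_cost n a b (y : R -> 'rV[R]_n) t :
  (forall r, 0 <= r -> a r = b r) -> cost a y t = cost b y t.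
Proof.
by move=> ab; apply: eq_integral => s _; rewrite ab// enorm_ge0.
Qed.

Lemma costZ n (c : R) a (w : R -> 'rV[R]_n) t :
  0 <= c -> class_Kinfty a -> is_input w ->
  cost (fun r => c * a r) w t = (c%:E * cost a w t)%E.
Proof.
move=> c0 Ka iw; rewrite /cost -ge0_integralZl//.
- exact: measurable_itv_completed.
- by apply/measurable_EFinP; exact: measurable_Kinfty_enorm.
- by move=> s _; rewrite lee_fin Kinfty_ge0// enorm_ge0.
Qed.

Lemma cost_ge0 n a (y : R -> 'rV[R]_n) t :
  class_Kinfty a -> (0 <= cost a y t)%E.
Proof.
move=> Ka; apply: integral_ge0 => s _.
by rewrite lee_fin Kinfty_ge0// enorm_ge0.
Qed.

End cost.

Theorem theorem2 (R : realType) (n m : nat)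
    (f : 'rV[R]_n -> 'rV[R]_m -> 'rV[R]_n)
    (f_lip : locally_lipschitz_fst f)
    (f_complete : forward_complete f) :
  (linear_L2_gain f -> ISS f) /\
  (forall gamma : R, 0 < gamma -> ISS f ->
     exists (S : 'rV[R]_m -> 'rV[R]_m) (T : 'rV[R]_n -> 'rV[R]_n),
       [/\ change_of_coordinates S, change_of_coordinates T &
         exists2 beta : R -> R, class_Kinfty beta &
           forall (w : R -> 'rV[R]_m) (x : R -> 'rV[R]_n) (t : R),
             is_input w -> solution f w x -> 0 <= t ->
             (L2normsq (T \o x) t <=
                maxe (beta (enorm (T (x 0))))%:E
                     ((gamma ^+ 2)%:E * L2normsq (S \o w) t))%E]).
Proof.
have Ksqr := @Kinfty_sqr R.
split=> [[beta [gamma [Kbeta gamma_ge0 gain]]]|gamma gamma_gt0].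
- (* The summand 1 keeps [sigma] of class K_infinity when [gamma = 0]. *)
  have c_gt0 : 0 < gamma ^+ 2 + 1 by rewrite ltr_wpDl// sqr_ge0.
  exists (fun r => r ^+ 2), beta, (fun r => (gamma ^+ 2 + 1) * r ^+ 2).
  split=> //; first exact: Kinfty_comp (Kinfty_scale c_gt0) Ksqr.
  move=> w x t iw xsol t0; apply: le_trans (gain w x t iw xsol t0) _.
  rewrite ge_max !le_max lexx/=; apply/orP; right.
  (* What remains is to compare the input terms, whose factors are [gamma ^+ 2] and
     [gamma ^+ 2 + 1]. *)
  rewrite (@costZ _ _ _ (fun r => r ^+ 2))// ?(ltW c_gt0)//.
  by rewrite lee_wpmul2r ?lee_fin ?lerDl//; exact: cost_ge0.
- case=> alpha [beta [sigma [Kalpha Kbeta Ksigma iss]]].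
  have c_gt0 : 0 < (gamma ^+ 2)^-1 by rewrite invr_gt0 exprn_gt0.
  have KT := Kinfty_comp (@Kinfty_sqrt R) Kalpha.
  have KcS := Kinfty_comp (Kinfty_scale c_gt0) Ksigma.
  have KS := Kinfty_comp (@Kinfty_sqrt R) KcS.
  (* [T'] recovers the norm of the initial state from its norm in the new coordinates. *)
  have [T' KT' [TK _]] := Kinfty_inv KT.
  exists (radial (Num.sqrt \o (( *%R (gamma ^+ 2)^-1) \o sigma))).
  exists (radial (Num.sqrt \o alpha)).
  split; [by apply: change_of_coordinates_radial..|].
  exists (beta \o T'); first exact: Kinfty_comp.
  move=> w x t iw xsol t0; rewrite /L2normsq !cost_radial//.
  rewrite enorm_radial//= TK ?enorm_ge0//.
  rewrite (@eq_cost _ _ _ alpha); last first.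
    by move=> r r0 /=; rewrite sqr_sqrtr// Kinfty_ge0.
  (* The gain factor goes inside the integral, where it cancels the [(gamma ^+ 2)^-1] built into the
     input coordinates. *)
  rewrite -costZ ?sqr_ge0//; last exact: Kinfty_comp.
  rewrite (@eq_cost _ _ _ sigma w); first exact: iss.
  move=> r r0 /=; rewrite sqr_sqrtr; last exact: (Kinfty_ge0 KcS).
  by rewrite mulrA divff ?mul1r// gt_eqF// exprn_gt0.
Qed.
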